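(* Suppose that the gross payoffs satisfy (P1)–(P5) and the cost functional satisfies (C1)–(C3). For $F\in\mathcal F$ and $x\in X$ let $a_F(x)=\mathbb E[\pi_1(x,X_2,\dots,X_n)]$ with $X_2,\dots,X_n\sim dF$ i.i.d., and let $\Phi(F,x)=a_F(x)-c_F(x)$. If $F\in\mathcal F$ is a symmetric equilibrium, then there exists $\lambda_g\in\mathbb R$ such that $$\Phi(F,x)\le\lambda_g\quad\text{for all }x\in X,\qquad\text{and}\qquad \Phi(F,x)=\lambda_g\quad\text{for all }x\in\operatorname{supp}(dF).$$
   Context: Let $n\ge 2$ and $X=[0,1]$. Let $\mathcal F$ be the set of cdfs on $X$: right-continuous nondecreasing $F:[0,1]\to[0,1]$ with $F(1)=1$. Each $F\in\mathcal F$ induces a unique Borel probability measure $dF$ on $X$ with $dF([0,x])=F(x)$; $\operatorname{supp}(dF)$ is its support. $\mathcal F$ carries the topology of weak convergence of the measures $dF$. Each player $i$ chooses $F_i\in\mathcal F$; performances $X_i\sim dF_i$ are drawn independently. Gross payoffs are Borel functions $\pi_i:X^n\to\mathbb R$, $i=1,\dots,n$ (expected payoffs given the realized performances, after averaging over uniform tie-breaking), satisfying: (P1) there is $\bar\pi<\infty$ with $0\le\pi_i\le\bar\pi$ for all $i$; (P2) for every permutation $\sigma$ of $\{1,\dots,n\}$, every $i$ and $x$: $\pi_i(x_{\sigma(1)},\dots,x_{\sigma(n)})=\pi_{\sigma(i)}(x_1,\dots,x_n)$; (P3) $\pi_i$ is continuous at every $x\in X^n$ with $x_i\ne x_j$ for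 all $j\neq i$; (P4) for each $i$, $x_{-i}$, and $x_i'\ge x_i$: $\pi_i(x_i',x_{-i})\ge\pi_i(x_i,x_{-i})$; (P5) there is a bounded continuous symmetric function $\Pi:X^n\to\mathbb R$ with $\sum_{i=1}^n\pi_i(x)=\Pi(x)$ for all $x\in X^n$. The cost $C:\mathcal F\to\mathbb R$ satisfies: (C1) $C$ is convex and continuous with respect to weak convergence; (C2) for each $F\in\mathcal F$ there is a continuous $c_F:X\to\mathbb R$ such that for all $G\in\mathcal F$ the limit $\delta C(F;G-F)=\lim_{\varepsilon\downarrow0}\varepsilon^{-1}\left[C((1-\varepsilon)F+\varepsilon G)-C(F)\right]$ exists and equals $\int_X c_F(x)\,d(G-F)(x)$ (a choice of $c_F$, unique up to an additive constant, is fixed for each $F$); (C3) there is $\eta_1>0$ such that $c_F(1)\ge c_F(0)+\bar\pi+\eta_1$ for every $F\in\mathcal F$. Player $i$'s net payoff is $u_i(F_1,\dots,F_n)=\mathbb E[\pi_i(X_1,\dots,X_n)]-C(F_i)$. $F\in\mathcal F$ is a symmetric equilibrium if $u_1(F,F,\dots,F)\ge u_1(H,F,\dots,F)$ for all $H\in\mathcal F$. *)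

(* Defs.v *)
From HB Require Import structures.
From mathcomp Require Import all_boot all_order all_algebra all_fingroup.
From mathcomp Require Import all_classical all_reals all_analysis.

Set Implicit Arguments.
Unset Strict Implicit.
Unset Printing Implicit Defensive.

Import Order.TTheory GRing.Theory Num.Theory.
Import numFieldNormedType.Exports.

Local Open Scope classical_set_scope.
Local Open Scope ring_scope.

(** ** Cdfs on [0, 1] *)

(* A right-continuous nondecreasing F : [0, 1] -> [0, 1] with F 1 = 1 is
   encoded by its extension to R that vanishes on ]-oo, 0[ and equals 1 on
   [1, +oo[. F 0 is unconstrained: it is the mass of the atom at 0. *)
Record cdf01 (R : realType) := Cdf01 {
  cdf01_fun :> R -> R ;
  cdf01_nondecreasing : nondecreasing cdf01_fun ;
  cdf01_right_continuous : right_continuous cdf01_fun ;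
  cdf01_lt0 : forall x, x < 0 -> cdf01_fun x = 0 ;
  cdf01_ge1 : forall x, 1 <= x -> cdf01_fun x = 1 }.

Lemma cdf01_inj (R : realType) (F G : cdf01 R) : F =1 G -> F = G.
Proof.
case: F G => [f f1 f2 f3 f4] [g g1 g2 g3 g4] /= /funext fg.
by subst g; congr Cdf01; exact: Prop_irrelevance.
Qed.

HB.instance Definition _ (R : realType) := gen_eqMixin (cdf01 R).
HB.instance Definition _ (R : realType) := gen_choiceMixin (cdf01 R).

Section law.
Context {R : realType}.
Implicit Type F : cdf01 R.

HB.instance Definition _ F := isCumulative.Build R _ R (cdf01_fun F)
  (@cdf01_nondecreasing _ F) (@cdf01_right_continuous _ F).

Let cdf01_cvgNy F : cdf01_fun F @ -oo --> (0 : R).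
Proof.
apply: cvg_near_cst; near=> x; apply: cdf01_lt0.
by near: x; exact: nbhs_ninfty_lt.
Unshelve. all: by end_near. Qed.

Let cdf01_cvgy F : cdf01_fun F @ +oo --> (1 : R).
Proof.
apply: cvg_near_cst; near=> x; apply: cdf01_ge1.
by near: x; exact: nbhs_pinfty_ge.
Unshelve. all: by end_near. Qed.

HB.instance Definition _ F := isCumulativeBounded.Build R 0 1 (cdf01_fun F)
  (@cdf01_cvgNy F) (@cdf01_cvgy F).

(* The measure dF. The library's Lebesgue-Stieltjes measure lives on
   [measurableTypeR R]; it is retyped here as a measure on the Borel sets of R
   itself, which form the same sigma-algebra. *)
Definition law F : set R -> \bar R := lebesgue_stieltjes_measure (cdf01_fun F).

HB.instance Definition _ F := isMeasure.Build _ R R (law F)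
  (@measure0 _ _ _ (lebesgue_stieltjes_measure (cdf01_fun F)))
  (@measure_ge0 _ _ _ (lebesgue_stieltjes_measure (cdf01_fun F)))
  (@measure_semi_sigma_additive _ _ _
     (lebesgue_stieltjes_measure (cdf01_fun F))).

HB.instance Definition _ F := Measure_isProbability.Build _ R R (law F)
  (@probability_setT _ _ _ (lebesgue_stieltjes_measure (cdf01_fun F))).

Let law_itvNyc F x : law F `]-oo, x] = (F x)%:E.
Proof. exact: cdf_lebesgue_stieltjes_id. Qed.

Let law_itvNyo0 F : law F `]-oo, 0[ = 0%E.
Proof.
have -> : `]-oo, 0[%classic = \bigcup_n `]-oo, (- n.+1%:R^-1 : R)]%classic.
  apply/seteqP; split => [y|y [n _]] /=; rewrite !in_itv/= => y0.
    have /ltr_add_invr[n] : 0 < - y by rewrite oppr_gt0.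
    by rewrite add0r => /ltW yn; exists n => //=; rewrite in_itv/= lerNr.
  by rewrite (le_lt_trans y0)// oppr_lt0 invr_gt0.
apply/negligibleP; first exact: bigcup_measurable.
apply: negligible_bigcup => n; apply/negligibleP => //.
by have := law_itvNyc F (- n.+1%:R^-1); rewrite cdf01_lt0// oppr_lt0 invr_gt0.
Qed.

Lemma law_itv F (x : R) : 0 <= x -> law F `[0, x] = (F x)%:E.
Proof.
move=> x0; rewrite -law_itvNyc.
have -> : `]-oo, x]%classic = `]-oo, 0[ `|` `[0, x].
  by rewrite -itv_bndbnd_setU// bnd_simp.
transitivity (law F `]-oo, 0%R[ + law F `[0%R, x])%E.
  by rewrite law_itvNyo0 add0e.
apply/esym/measureU => //.
apply/seteqP; split => // y [] /=; rewrite !in_itv/= => y0 /andP[].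
by rewrite leNgt y0.
Qed.

End law.

(** ** Weak convergence *)

(* Values of the test functions f outside [0, 1] are irrelevant. *)
Definition weak_cdf_ev (R : realType) (F : cdf01 R) :
    {ptws {f : R -> R | {within `[0, 1], continuous f}} -> R} :=
  fun f => \int[law F]_(x in `[0, 1]) (sval f x).

HB.instance Definition _ (R : realType) :=
  Topological.copy (cdf01 R) (initial_topology (@weak_cdf_ev R)).

Lemma weak_cdf_cvgP (R : realType) (u : (cdf01 R)^nat) (F : cdf01 R) :
  u @ \oo --> F <->
  forall f : R -> R, {within `[0, 1], continuous f} ->
    \int[law (u k)]_(x in `[0, 1]) f x @[k --> \oo] -->
    \int[law F]_(x in `[0, 1]) f x.
Proof.
split=> [uF f cf|h].
  have evF : weak_cdf_ev (u k) @[k --> \oo] --> weak_cdf_ev F.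
    by apply: continuous_cvg uF; exact: initial_continuous.
  have /cvg_sup/(_ (exist _ f cf)) evFf := evF.
  have := continuous_cvg _ (@initial_continuous _ _ _ _) evFf.
  exact.
have evu : weak_cdf_ev (u k) @[k --> \oo] --> weak_cdf_ev F.
  apply/cvg_sup => -[f cf]; apply/cvg_image.
    by apply/seteqP; split => // y _; exists (fun=> y).
  move=> A /(h f cf) hA; exists ((fun v => v (exist _ f cf)) @^-1` A) => //.
  by apply/seteqP; split => [y [v vA <-]//|y yA]; exists (fun=> y).
move=> A; rewrite nbhsE => -[_ [[B oB <-] BF] BA].
have nB : nbhs (weak_cdf_ev F) B by exact: (open_nbhs_nbhs (conj oB BF)).
by exact: (@filterS _ \oo _ _ _ (fun k => BA (u k)) (evu B nB)).
Qed.

(** ** Convex combinations *)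

Section mix.
Context {R : realType}.
Implicit Types F G : cdf01 R.

Definition clamp01 (t : R) : R := Num.max 0 (Num.min t 1).

Lemma clamp01_id t : 0 <= t <= 1 -> clamp01 t = t.
Proof. by move=> /andP[t0 t1]; rewrite /clamp01 min_l// max_r. Qed.

Lemma clamp01_itv t : 0 <= clamp01 t <= 1.
Proof. by rewrite /clamp01 le_max lexx ge_max ler01 ge_min lexx orbT. Qed.

Let mix_fun t F G x := (1 - clamp01 t) * F x + clamp01 t * G x.

Let mix_nd t F G : nondecreasing (mix_fun t F G).
Proof.
move=> x y xy; have /andP[t0 t1] := clamp01_itv t.
by rewrite lerD// ler_wpM2l ?subr_ge0// cdf01_nondecreasing.
Qed.

Let mix_rc t F G : right_continuous (mix_fun t F G).
Proof.
by move=> x; apply: cvgD; apply: cvgMr; exact: cdf01_right_continuous.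
Qed.

Let mix_lt0 t F G x : x < 0 -> mix_fun t F G x = 0.
Proof. by move=> x0; rewrite /mix_fun !cdf01_lt0// !mulr0 addr0. Qed.

Let mix_ge1 t F G x : 1 <= x -> mix_fun t F G x = 1.
Proof. by move=> x1; rewrite /mix_fun !cdf01_ge1// !mulr1 subrK. Qed.

(* (1 - t) F + t G for t in [0, 1]; the truncation of t only serves to make
   [mix] total. *)
Definition mix t F G : cdf01 R :=
  Cdf01 (@mix_nd t F G) (@mix_rc t F G) (@mix_lt0 t F G) (@mix_ge1 t F G).

Lemma mixE t F G x : 0 <= t <= 1 -> mix t F G x = (1 - t) * F x + t * G x.
Proof. by move=> t01; rewrite /= /mix_fun clamp01_id. Qed.

End mix.

(** ** Profiles of performances *)

HB.instance Definition _ (n : nat) (T : topologicalType) :=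
  Topological.copy (n.-tuple T)
    (initial_topology
       ((fun x i => tnth x i) : n.-tuple T -> {ptws 'I_n -> T})).

(* [0, 1]^n; payoffs are functions on n.-tuple R, constrained and integrated
   only on this set. *)
Definition cube (R : realType) (n : nat) : set (n.-tuple R) :=
  [set x | forall i, 0 <= tnth x i <= 1].
Arguments cube : clear implicits.

Definition permute (T : Type) (n : nat) (s : 'S_n) (x : n.-tuple T) :
  n.-tuple T := [tuple tnth x (s j) | j < n].

Definition update (T : Type) (n : nat) (x : n.-tuple T) (i : 'I_n) (y : T) :
  n.-tuple T := [tuple if j == i then y else tnth x j | j < n].

Section product_probability.
Context d (T : measurableType d) (R : realType).

Definition cons_pair n (x : T * n.-tuple T) : n.+1.-tuple T :=
  [tuple of x.1 :: x.2].

Let measurable_cons_pair n : measurable_fun [set: _] (@cons_pair n).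
Proof. exact: measurable_cons. Qed.

HB.instance Definition _ n :=
  isMeasurableFun.Build _ _ _ _ (@cons_pair n) (@measurable_cons_pair n).

(* The joint law of n independent variables with laws P 0, ..., P (n - 1). *)
Fixpoint product_probability n :
    ('I_n -> probability T R) -> probability (n.-tuple T) R :=
  match n with
  | 0 => fun _ => \d_[tuple]
  | m.+1 => fun P =>
      distribution
        (P ord0 \x product_probability (fun i => P (lift ord0 i)))%E
        (@cons_pair m)
  end.

Lemma product_probabilityE n (P : 'I_n -> probability T R)
    (A : 'I_n -> set T) : (forall i, measurable (A i)) ->
  product_probability P [set x | forall i, A i (tnth x i)] =
  (\prod_(i < n) P i (A i))%E.
Proof.
elim: n => [|n IH] in P A *; move=> mA.
  by rewrite big_ord0 /= diracE mem_set//=; case.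
rewrite big_ord_recl -IH; last by move=> i; exact: mA.
rewrite /= /distribution /pushforward.
set B := [set x : n.-tuple T | forall i, A (lift ord0 i) (tnth x i)].
have mB : measurable B.
  have -> : B = \bigcap_(i in [set: 'I_n])
      ((fun x : n.-tuple T => tnth x i) @^-1` A (lift ord0 i)).
    by apply/seteqP; split => [x h i _|x h i]; [exact: h|exact: (h i I)].
  apply: fin_bigcap_measurable => // i _; rewrite -[X in measurable X]setTI.
  exact: measurable_tnth.
rewrite -product_measure1E//; congr (_ _).
apply/seteqP; split => [[x t] /= h|[x t] /= [Ax At] i].
  by split; [exact: (h ord0)|move=> i; have := h (lift ord0 i); rewrite tnthS].
by case: (unliftP ord0 i) => [j|] ->; rewrite ?tnthS//; exact: At.
Qed.

End product_probability.

(** ** The game *)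

Section game.
Context {R : realType}.

Record gross_payoffs (n : nat) (pibar : R) (payoff : 'I_n -> n.-tuple R -> R) :
    Prop := GrossPayoffs {
  payoff_measurable : forall i, measurable_fun (cube R n) (payoff i) ;
  payoff_bounded : forall i x, cube R n x -> 0 <= payoff i x <= pibar ;
  payoff_permute : forall (s : 'S_n) i x, cube R n x ->
    payoff i (permute s x) = payoff (s i) x ;
  payoff_continuous : forall i x, cube R n x ->
    (forall j, j != i -> tnth x i != tnth x j) ->
    payoff i y @[y --> within (cube R n) (nbhs x)] --> payoff i x ;
  payoff_nondecreasing : forall i x (y : R), cube R n x -> 0 <= y <= 1 ->
    tnth x i <= y -> payoff i x <= payoff i (update x i y) ;
  payoff_total : exists Pi : n.-tuple R -> R,
    [/\ exists M, forall x, cube R n x -> `|Pi x| <= M,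
        {within cube R n, continuous Pi},
        forall (s : 'S_n) x, cube R n x -> Pi (permute s x) = Pi x &
        forall x, cube R n x -> \sum_(i < n) payoff i x = Pi x] }.

(* [c F] is the chosen representative of the Gateaux derivative of C at F. *)
Record cost_functional (pibar : R) (C : cdf01 R -> R) (c : cdf01 R -> R -> R) :
    Prop := CostFunctional {
  cost_convex : forall F G (t : R), 0 <= t <= 1 ->
    C (mix t F G) <= (1 - t) * C F + t * C G ;
  cost_continuous : continuous C ;
  cost_derivative_continuous : forall F, {within `[0, 1], continuous (c F)} ;
  (* for e in ]0, 1], [mix e F G] is (1 - e) F + e G *)
  cost_derivative : forall F G,
    e^-1 * (C (mix e F G) - C F) @[e --> 0^'+] -->
    \int[law G]_(x in `[0, 1]) c F x - \int[law F]_(x in `[0, 1]) c F x ;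
  cost_steep : exists2 eta1 : R, 0 < eta1 &
    forall F, c F 0 + pibar + eta1 <= c F 1 }.

Definition net_payoff (n : nat) (payoff : 'I_n -> n.-tuple R -> R)
    (C : cdf01 R -> R) (i : 'I_n) (F : 'I_n -> cdf01 R) : R :=
  \int[product_probability (fun j => law (F j))]_(x in cube R n) payoff i x
  - C (F i).

(* Player 1 is [ord0]. *)
Definition symmetric_equilibrium (n : nat)
    (payoff : 'I_n.+1 -> n.+1.-tuple R -> R)
    (C : cdf01 R -> R) (F : cdf01 R) : Prop :=
  forall H : cdf01 R,
    net_payoff payoff C ord0 (fun j => if j == ord0 then H else F) <=
    net_payoff payoff C ord0 (fun=> F).

(* a_F(x) = E[pi_1(x, X_2, ..., X_n)] in the game with n.+1 players. *)
Definition interim_payoff (n : nat) (payoff : 'I_n.+1 -> n.+1.-tuple R -> R)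
    (F : cdf01 R) (x : R) : R :=
  \int[product_probability (fun _ : 'I_n => law F)]_(t in cube R n)
    payoff ord0 [tuple of x :: t].

Definition Phi (n : nat) (payoff : 'I_n.+1 -> n.+1.-tuple R -> R)
    (c : cdf01 R -> R -> R) (F : cdf01 R) (x : R) : R :=
  interim_payoff payoff F x - c F x.

End game.

Definition measure_support (T : topologicalType) (R : realType)
    (mu : set T -> \bar R) : set T :=
  [set x | forall U, open U -> U x -> (0 < mu U)%E].

(* Main.v *)
(* Deviating from F to (1 - e) F + e G and letting e tend to 0 shows that
   int Phi(F, .) dG <= int Phi(F, .) dF =: lambda for every G; taking for G a
   point mass gives Phi(F, .) <= lambda on [0, 1], hence Phi(F, .) = lambda
   dF-almost everywhere. In particular Phi(F, x) = lambda if x is an atom of F.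
   If x is a point of the support but not an atom, then it is a limit of points
   where Phi(F, .) = lambda, and a_F is continuous at x by dominated
   convergence, since almost surely no opponent ties with x. *)
Require Import Defs.
From HB Require Import structures.
From mathcomp Require Import all_boot all_order all_algebra all_fingroup.
From mathcomp Require Import ring lra.
From mathcomp Require Import all_classical all_reals all_analysis.
From mathcomp Require Import measurable_realfun.
Import Order.TTheory GRing.Theory Num.Theory.
Import numFieldNormedType.Exports.
Local Open Scope classical_set_scope.
Local Open Scope ring_scope.

(** * Integration against dF: mixtures and point masses *)

Section law_integral.
Context {R : realType}.
Implicit Types F G : cdf01 R.

Lemma law_itvoc F (a b : R) : a <= b -> law F `]a, b]%classic = (F b - F a)%:E.
Proof.
move=> ab; rewrite /law /lebesgue_stieltjes_measure /measure_extension/=.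
by rewrite measurable_mu_extE/= ?wlength_itv_bnd//; exact: is_ocitv.
Qed.

(** Half-open intervals generate the Borel sets, so the increments of F determine dF. This
    identifies the laws of mixtures and of point masses below. *)
Lemma law_unique F (mu : {measure set R -> \bar R}) :
  (forall a b : R, a <= b -> mu `]a, b]%classic = (F b - F a)%:E) ->
  forall A, measurable A -> law F A = mu A.
Proof.
move=> muF A mA.
(* The library's uniqueness lemma needs mu on [measurableTypeR R] instead of on
   the Borel sets of R. *)
pose muf := mu : set (measurableTypeR R) -> \bar R.
pose mu_isMeasure := isMeasure.Build _ (measurableTypeR R) R muf
  (@measure0 _ _ _ mu) (@measure_ge0 _ _ _ mu)
  (@measure_semi_sigma_additive _ _ _ mu).
pose nu : measure (measurableTypeR R) R := HB.pack muf mu_isMeasure.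
apply: (@lebesgue_stieltjes_measure_unique R (cdf01_fun F) nu) => //.
move=> _ [[a b] /= _ <-].
have [ab|ba] := leP a b; first by rewrite [RHS]muF// -law_itvoc.
by rewrite set_itv_ge ?measure0// bnd_simp -leNgt ltW.
Qed.

(** The law of the mixture is the measure (1 - t) dF + t dG, as both give ]a, b] the same mass;
    nonnegative integrands then split over the sum of measures. *)
Lemma integral_law_mix (t : R) F G (D : set R) (f : R -> \bar R) :
  0 <= t <= 1 -> measurable D -> measurable_fun D f ->
  (forall x, D x -> (0 <= f x)%E) ->
  (\int[law (mix t F G)]_(x in D) f x =
   (1 - t)%:E * \int[law F]_(x in D) f x + t%:E * \int[law G]_(x in D) f x)%E.
Proof.
move=> t01 mD mf f0; have /andP[t0 t1] := t01.
have t1' : 0 <= 1 - t by rewrite subr_ge0.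
transitivity (\int[measure_add (mscale (NngNum t1') (law F))
                               (mscale (NngNum t0) (law G))]_(x in D) f x)%E.
  apply: eq_measure_integral => A mA _; apply: law_unique => // a b ab.
  transitivity ((1 - t)%:E * law F `]a, b]%classic +
                t%:E * law G `]a, b]%classic)%E; first exact: measure_addE.
  rewrite !law_itvoc// -!EFinM -EFinD.
  by rewrite !mixE// /=; congr EFin; ring.
by rewrite ge0_integral_measure_add// !ge0_integral_mscale.
Qed.

Lemma Rintegral_law_mix (t : R) F G (D : set R) (f : R -> R) :
  0 <= t <= 1 -> measurable D -> (forall x, D x -> 0 <= f x) ->
  (law F).-integrable D (EFin \o f) -> (law G).-integrable D (EFin \o f) ->
  \int[law (mix t F G)]_(x in D) f x =
  (1 - t) * \int[law F]_(x in D) f x + t * \int[law G]_(x in D) f x.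
Proof.
move=> t01 mD f0 fF fG; rewrite /Rintegral integral_law_mix//.
- by rewrite fineD ?fineM ?fin_numM//; exact: integrable_fin_num.
- by case/integrableP: fF.
Qed.

Let dirac_fun (x y : R) : R := (x <= y)%R%:R.

Let dirac_nd x : nondecreasing (dirac_fun x).
Proof.
move=> y z yz; rewrite /dirac_fun ler_nat.
by case: leP => // /le_trans/(_ yz) ->.
Qed.

Let dirac_rc x : right_continuous (dirac_fun x).
Proof.
(* The step is constant just to the right of y: it stays 1 if x <= y, and stays 0 up to x
   otherwise. *)
move=> y; apply: cvg_near_cst; rewrite /dirac_fun.
have [xy|yx] := leP x y; near=> z.
  by rewrite (le_trans xy)//; near: z; exact: nbhs_right_ge.
by rewrite leNgt; have -> : z < x by near: z; exact: nbhs_right_lt.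
Unshelve. all: by end_near. Qed.

Let dirac_lt0 x : 0 <= x <= 1 -> forall y, y < 0 -> dirac_fun x y = 0.
Proof.
by move=> /andP[x0 _] y y0; rewrite /dirac_fun leNgt (lt_le_trans y0).
Qed.

Let dirac_ge1 x : 0 <= x <= 1 -> forall y, 1 <= y -> dirac_fun x y = 1.
Proof. by move=> /andP[_ x1] y y1; rewrite /dirac_fun (le_trans x1). Qed.

Definition dirac_cdf01 x (x01 : 0 <= x <= 1) : cdf01 R :=
  Cdf01 (dirac_nd x) (dirac_rc x) (dirac_lt0 _ x01) (dirac_ge1 _ x01).

Lemma Rintegral_law_dirac x (x01 : 0 <= x <= 1) (D : set R) (f : R -> R) :
  measurable D -> measurable_fun D f -> D x ->
  \int[law (dirac_cdf01 x x01)]_(y in D) f y = f x.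
Proof.
move=> mD mf Dx; rewrite /Rintegral (eq_measure_integral \d_x).
  rewrite integral_dirac//; last exact/measurable_EFinP.
  by rewrite diracE mem_set// mul1e.
move=> A mA _; apply: law_unique => // a b ab.
transitivity ((x \in `]a, b]%classic)%:R%:E : \bar R); first exact: diracE.
rewrite /= /dirac_fun.
have -> : (x \in `]a, b]%classic) = (a < x <= b).
  by apply/idP/idP; rewrite inE/= in_itv.
have [ax|xa] := ltP a x; first by rewrite subr0.
by rewrite (le_trans xa ab) subrr.
Qed.

Lemma law_setC01 F : law F (~` `[0, 1]) = 0%E.
Proof.
transitivity (1 - law F `[0%R, 1%R]%classic)%E; first exact: probability_setC.
by rewrite law_itv// cdf01_ge1// subee.
Qed.

End law_integral.

(** * Tonelli for the joint law, splitting off the first coordinate *)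

Section product_probability_integral.
Context d (T : measurableType d) (R : realType).

Lemma ge0_integral_product_probability n (P : 'I_n.+1 -> probability T R)
    (f : n.+1.-tuple T -> \bar R) :
  measurable_fun setT f -> (forall x, (0 <= f x)%E) ->
  (\int[product_probability P]_x f x =
   \int[P ord0]_x
     \int[product_probability (fun i => P (lift ord0 i))]_t
       f (cons_pair (x, t)))%E.
Proof.
move=> mf f0; rewrite /= /distribution ge0_integral_pushforward//.
rewrite preimage_setT fubini_tonelli1//.
  exact: measurableT_comp.
by move=> x; exact: f0.
Qed.

End product_probability_integral.

(** * Measurability and decomposition of the cube *)

Section cube.
Context {R : realType}.

Lemma measurable_cube n : measurable (cube R n).
Proof.
have -> : cube R n = \bigcap_(i in [set: 'I_n])
    ((fun x : n.-tuple R => tnth x i) @^-1` `[0, 1]).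
  apply/seteqP; split => [x h i _|x h i] /=; first by rewrite in_itv; exact: h.
  by have := h i I; rewrite /= in_itv.
apply: fin_bigcap_measurable => // i _; rewrite -[X in measurable X]setTI.
exact: measurable_tnth.
Qed.

Lemma cube_cons n (x : R) (t : n.-tuple R) :
  cube R n.+1 [tuple of x :: t] <-> 0 <= x <= 1 /\ cube R n t.
Proof.
split=> [h|[x01 h] i].
  by split; [exact: (h ord0)|move=> i; have := h (lift ord0 i); rewrite tnthS].
by case: (unliftP ord0 i) => [j|] ->; rewrite ?tnthS//; exact: h.
Qed.

End cube.

(** * The interim payoff: measurability, bounds, and its link to expected payoffs *)

Section interim.
Context {R : realType} (n : nat) (M : R).
Variable payoff : 'I_n.+1 -> n.+1.-tuple R -> R.
Hypothesis mf : measurable_fun (cube R n.+1) (payoff ord0).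
Hypothesis f0 : forall x, cube R n.+1 x -> 0 <= payoff ord0 x <= M.
Implicit Types F H : cdf01 R.

(** Extending the payoff by 0 outside the cube gives a nonnegative measurable function on the whole
    space, to which Tonelli applies. *)
Let g : n.+1.-tuple R -> \bar R := (EFin \o payoff ord0) \_ (cube R n.+1).

Let mg : measurable_fun setT g.
Proof.
apply/measurable_restrict => //; first exact: measurable_cube.
by rewrite setTI; exact/measurable_EFinP.
Qed.

Let g0 x : (0 <= g x)%E.
Proof.
by rewrite /g patchE; case: ifPn => // /set_mem /f0/andP[]; rewrite lee_fin.
Qed.

Lemma measurable_payoff_cons (x : R) : 0 <= x <= 1 ->
  measurable_fun (cube R n)
    (fun t : n.-tuple R => payoff ord0 [tuple of x :: t]).
Proof.
move=> x01.
apply: (@measurable_comp _ _ _ _ _ _ (cube R n.+1) (payoff ord0) _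
  (fun t : n.-tuple R => [tuple of x :: t])) => //; first exact: measurable_cube.
  by move=> _ [t ct <-]; apply/cube_cons.
apply: measurable_funTS; exact: measurable_cons.
Qed.

Lemma integrable_payoff_cons (mu : probability (n.-tuple R) R) (x : R) :
  0 <= x <= 1 ->
  mu.-integrable (cube R n)
    (EFin \o (fun t : n.-tuple R => payoff ord0 [tuple of x :: t])).
Proof.
move=> x01; apply: measurable_bounded_integrable => //.
- exact: measurable_cube.
- rewrite (le_lt_trans (probability_le1 _ _))// ?ltry//.
  exact: measurable_cube.
- exact: measurable_payoff_cons.
- exists `|M|; split => // y My t ct /=.
  have /f0/andP[p0 pM] : cube R n.+1 [tuple of x :: t] by apply/cube_cons.
  by rewrite ger0_norm// (le_trans pM)// (le_trans (ler_norm _))// ltW.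
Qed.

Let interimE F (x : R) : 0 <= x <= 1 ->
  (\int[product_probability (fun _ : 'I_n => law F)]_t g (cons_pair (x, t)))%E
  = (interim_payoff payoff F x)%:E.
Proof.
move=> x01; rewrite /interim_payoff /Rintegral fineK; last first.
  apply: integrable_fin_num; first exact: measurable_cube.
  exact: integrable_payoff_cons.
rewrite [RHS]integral_mkcond; apply: eq_integral => t _.
rewrite /g !patchE /=; congr (if _ then _ else _).
by apply/idP/idP => /set_mem;
  [move=> /cube_cons[_] /mem_set|move=> ct; apply/mem_set/cube_cons].
Qed.

Let gF F (x : R) :=
  (\int[product_probability (fun _ : 'I_n => law F)]_t g (cons_pair (x, t)))%E.

Let mgF F : measurable_fun setT (gF F).
Proof.
apply: (@measurable_fun_fubini_tonelli_F _ _ _ _ _ _ (g \o @cons_pair _ R n)).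
   exact: (measurableT_comp mg).
by move=> x; exact: g0.
Qed.

(** On [0, 1] the interim payoff is the inner Tonelli integral [gF] of [g], which is measurable in x
    on all of R. *)
Lemma measurable_interim_payoff F :
  measurable_fun (`[0, 1]%classic : set R) (interim_payoff payoff F).
Proof.
apply/measurable_EFinP.
apply: (eq_measurable_fun (gF F)); last exact: measurable_funTS.
by move=> x; rewrite inE /= in_itv/= => x01; rewrite /gF interimE.
Qed.

(** Tonelli, with the deviator's coordinate integrated last. It shows that the expected gross payoff
    depends on the deviation H only through integration against dH. *)
Lemma expected_payoff H F :
  \int[product_probability
         (fun j : 'I_n.+1 => law (if j == ord0 then H else F))]_(x in cube R n.+1)
    payoff ord0 x =
  \int[law H]_(x in `[0, 1]) interim_payoff payoff F x.
Proof.
rewrite /Rintegral; congr fine.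
rewrite integral_mkcond -/g ge0_integral_product_probability//.
rewrite [RHS]integral_mkcond; apply: eq_integral => x _.
rewrite [RHS]patchE; case: ifPn => [|x01].
  by rewrite inE /= in_itv/= => x01; rewrite -interimE.
(* For x outside [0, 1] no profile (x, t) lies in the cube, so both integrands vanish. *)
apply: integral0_eq => t _; rewrite /g patchE; case: ifPn => //.
move/set_mem/cube_cons => -[/= h _]; move: x01; rewrite notin_setE/=.
by rewrite in_itv.
Qed.

Lemma interim_payoff_itv F (x : R) :
  0 <= x <= 1 -> 0 <= interim_payoff payoff F x <= M.
Proof.
move=> x01.
(* The sign of M is read off from the payoff bounds at the zero profile. *)
have M0 : 0 <= M.
  have /f0/andP[] : cube R n.+1 [tuple of nseq n.+1 0].
    by move=> i; rewrite tnth_nseq lexx ler01.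
  exact: le_trans.
apply/andP; split.
  apply: Rintegral_ge0 => t ct.
  by have /f0/andP[] : cube R n.+1 [tuple of x :: t] by apply/cube_cons.
apply: (@le_trans _ _
    (\int[product_probability (fun _ : 'I_n => law F)]_(t in cube R n) M)).
  apply: le_Rintegral; first exact: measurable_cube.
  - exact: integrable_payoff_cons.
  - apply: finite_measure_integrable_cst; exact: measurable_cube.
  move=> t ct.
  by have /f0/andP[] : cube R n.+1 [tuple of x :: t] by apply/cube_cons.
rewrite Rintegral_cst; last exact: measurable_cube.
rewrite ler_piMr// -lee_fin fineK ?fin_num_measure//;
  last exact: measurable_cube.
by apply: probability_le1; exact: measurable_cube.
Qed.

End interim.

(** * Continuity of the interim payoff at points that are not atoms *)

Lemma cvg_tuple_cons (T : topologicalType) n (y : nat -> T) (x : T)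
    (t : n.-tuple T) :
  y k @[k --> \oo] --> x ->
  ([tuple of y k :: t] : n.+1.-tuple T) @[k --> \oo] -->
  ([tuple of x :: t] : n.+1.-tuple T).
Proof.
move=> yx A; rewrite nbhsE => -[_ [[B oB <-] Bx] BA].
pose ev (z : n.+1.-tuple T) : {ptws 'I_n.+1 -> T} := fun i => tnth z i.
have evy : ev [tuple of y k :: t] @[k --> \oo] --> ev [tuple of x :: t].
  apply/cvg_sup => i; apply/cvg_image.
    by apply/seteqP; split => // z _; exists (fun=> z).
  move=> C Cx.
  have hC : \forall k \near \oo, C (ev [tuple of y k :: t] i).
    case: (unliftP ord0 i) Cx => [j|] -> Cx; last exact: (yx C Cx).
    apply: nearW => k; move: (nbhs_singleton Cx).
    by rewrite /ev/= !tnthS.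
  exists ((fun v => v i) @^-1` C); first exact: hC.
  by apply/seteqP; split => [z [v vA <-]//|z zC]; exists (fun=> z).
have nB : nbhs (ev [tuple of x :: t]) B by exact: (open_nbhs_nbhs (conj oB Bx)).
by exact: (@filterS _ \oo _ _ _ (fun k => BA [tuple of y k :: t]) (evy B nB)).
Qed.

(** The event that every coordinate avoids x is a box, whose probability is a product of factors 1 -
    dF({x}) = 1. *)
Lemma product_probability_avoid (R : realType) n (F : cdf01 R) (x : R) :
  law F [set x] = 0%E ->
  {ae product_probability (fun _ : 'I_n => law F),
    forall t, forall i, tnth t i != x}.
Proof.
move=> Fx0; set mu := product_probability _.
pose A (_ : 'I_n) : set R := ~` [set x].
have mA i : measurable (A i) by apply: measurableC.
pose N := [set t : n.-tuple R | forall i, A i (tnth t i)].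
have mN : measurable N.
  have -> : N = \bigcap_(i in [set: 'I_n])
      ((fun t : n.-tuple R => tnth t i) @^-1` A i).
    by apply/seteqP; split => [t h i _|t h i]; [exact: h|exact: (h i I)].
  apply: fin_bigcap_measurable => // i _; rewrite -[X in measurable X]setTI.
  exact: measurable_tnth.
exists (~` N); split; first exact: measurableC.
- have muN : mu N = 1%E.
    rewrite /mu product_probabilityE// big1// => i _.
    transitivity (1 - law F [set x])%E; first exact: probability_setC.
    by rewrite Fx0 sube0.
  by rewrite probability_setC// muN subee.
- by move=> t /= h Nt; apply: h => i; apply/eqP; exact: (Nt i).
Qed.

(** Dominated convergence with the constant bound M: by (P3) the integrand converges at each t with
    no coordinate equal to x, hence for almost every t. *)
Lemma interim_payoff_cvg (R : realType) (n : nat) (M : R)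
    (payoff : 'I_n.+1 -> n.+1.-tuple R -> R) (F : cdf01 R) (x : R)
    (y : nat -> R) :
  gross_payoffs M payoff -> law F [set x] = 0%E -> 0 <= x <= 1 ->
  (forall k, 0 <= y k <= 1) -> y @ \oo --> x ->
  interim_payoff payoff F (y k) @[k --> \oo] --> interim_payoff payoff F x.
Proof.
move=> [pm pb _ pc _ _] Fx0 x01 y01 yx.
have [|||||_ _] := @dominated_convergence _ _ R
  (product_probability (fun _ : 'I_n => law F)) (cube R n) (measurable_cube n)
  (fun k t => (payoff ord0 [tuple of y k :: t])%:E)
  (fun t => (payoff ord0 [tuple of x :: t])%:E) (cst M%:E).
- move=> k; apply/measurable_EFinP; exact: measurable_payoff_cons.
- apply/measurable_EFinP; exact: measurable_payoff_cons.
- apply: filterS (product_probability_avoid R n F x Fx0) => t tx ct.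
  apply: cvg_EFin.
    by apply: nearW.
  have cxt : cube R n.+1 [tuple of x :: t] by apply/cube_cons.
  have pcx : payoff ord0 z @[z --> within (cube R n.+1)
      (nbhs ([tuple of x :: t] : n.+1.-tuple R))] -->
      payoff ord0 [tuple of x :: t].
    apply: pc => // j; case: (unliftP ord0 j) => [i|] ->; last by rewrite eqxx.
    by move=> _; rewrite tnthS eq_sym; exact: tx.
  (* Continuity is only relative to the cube, so the approximating profiles must be seen to stay in
     it. *)
  apply: (cvg_comp (fun k => [tuple of y k :: t]) (payoff ord0) _ pcx).
  move=> A /= h.
  have yA : \forall k \near \oo, cube R n.+1 [tuple of y k :: t] ->
      A [tuple of y k :: t] := cvg_tuple_cons R n y x t yx _ h.
  by apply: filterS yA => k; apply; apply/cube_cons.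
- apply: finite_measure_integrable_cst; exact: measurable_cube.
- apply: aeW => t k ct.
  have /(pb ord0)/andP[p0 pM] : cube R n.+1 [tuple of y k :: t].
    exact/cube_cons.
  by rewrite /= lee_fin ger0_norm.
move=> h; apply: fine_cvg.
rewrite fineK; first exact: h.
apply: integrable_fin_num; first exact: measurable_cube.
exact: (integrable_payoff_cons n M payoff (pm ord0) (pb ord0)).
Qed.

(** * Points of the support *)

Lemma support_law_itv (R : realType) (F : cdf01 R) (x : R) :
  measure_support (law F) x -> 0 <= x <= 1.
Proof.
move=> sx; apply/negPn/negP => x01.
pose I01 : set R := `[0, 1]%classic.
have := sx (~` I01).
rewrite law_setC01 ltxx => h; suff : false by [].
apply: h; first by apply/closed_openC; exact: interval_closed.
by rewrite /I01 /= in_itv; exact/negP.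
Qed.

(** Every ball around a support point has positive mass, so it cannot be covered by the exceptional
    null set and the null complement of [0, 1]. The sequence picks a good point in the ball of
    radius 1/(k + 1). *)
Lemma support_approx (R : realType) (F : cdf01 R) (x : R) (P : R -> Prop) :
  measure_support (law F) x ->
  {ae law F, forall y, `[0, 1]%classic y -> P y} ->
  exists2 y : nat -> R, (forall k, 0 <= y k <= 1 /\ P (y k)) & y @ \oo --> x.
Proof.
move=> sx [N [mN N0 PN]]; set I01 : set R := `[0, 1]%classic.
have mI01 : measurable I01 by exact: measurable_itv.
have ex k : exists y, ball x k.+1%:R^-1 y /\ (0 <= y <= 1 /\ P y).
  apply: contrapT => /forallNP nex.
  have r0 : 0 < k.+1%:R^-1 :> R by rewrite invr_gt0.
  have sub : ball x k.+1%:R^-1 `<=` N `|` ~` I01.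
    move=> y xy; have [I01y|] := pselect (I01 y); last by right.
    left; apply: PN => /= /(_ I01y) Py; apply: (nex y).
    by move: I01y; rewrite /I01 /= in_itv.
  have := sx _ (ball_open x _) (ballxx x r0); apply/negP; rewrite -leNgt.
  apply: (@le_trans _ _ (law F N + law F (~` I01))%E); last first.
    by rewrite N0 law_setC01 adde0.
  apply: (@le_trans _ _ (law F (N `|` ~` I01))).
    apply: le_measure => //; rewrite inE; first exact: measurable_ball.
    by apply: measurableU => //; exact: measurableC.
  by apply: measureU2 => //; exact: measurableC.
have [y yP] := choice ex.
exists y; first by move=> k; have [_ []] := yP k.
apply/cvgrPdist_lt => e e0.
near=> k; have [+ _] := yP k; rewrite /ball/= => /lt_trans; apply.
near: k; exact: (near_infty_natSinv_lt (PosNum e0)).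
Unshelve. all: by end_near. Qed.

(** * First-order conditions at a symmetric equilibrium *)

Section equilibrium.
Context {R : realType} (n : nat) (M : R).
Variables (payoff : 'I_n.+1 -> n.+1.-tuple R -> R).
Variables (C : cdf01 R -> R) (c : cdf01 R -> R -> R).
Hypothesis gp : gross_payoffs M payoff.
Hypothesis cf : cost_functional M C c.
Implicit Types F G H : cdf01 R.

Let I01 : set R := `[0, 1]%classic.

Let mI01 : measurable I01. Proof. exact: measurable_itv. Qed.

Let ma F : measurable_fun I01 (interim_payoff payoff F).
Proof.
case: gp => pm pb _ _ _ _.
exact: (measurable_interim_payoff n M _ (pm ord0) (pb ord0)).
Qed.

Let a01 F x : I01 x -> 0 <= interim_payoff payoff F x <= M.
Proof.
rewrite /I01 /= in_itv/= => x01.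
case: gp => pm pb _ _ _ _.
exact: (interim_payoff_itv n M _ (pm ord0) (pb ord0)).
Qed.

Let integrable_a (mu : probability R R) F :
  mu.-integrable I01 (EFin \o interim_payoff payoff F).
Proof.
apply: measurable_bounded_integrable => //.
- by rewrite (le_lt_trans (probability_le1 _ _))// ltry.
- exists `|M|; split => // y My t ct /=.
  have /andP[p0 pM] := a01 F t ct.
  by rewrite ger0_norm// (le_trans pM)// (le_trans (ler_norm _))// ltW.
Qed.

Let mc F : measurable_fun I01 (c F).
Proof.
case: cf => _ _ cc _ _.
have := cc F; apply: subspace_continuous_measurable_fun; exact: mI01.
Qed.

Let integrable_c (mu : probability R R) F :
  mu.-integrable I01 (EFin \o c F).
Proof.
apply: measurable_bounded_integrable => //.
- by rewrite (le_lt_trans (probability_le1 _ _))// ltry.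
- case: cf => _ _ cc _ _.
  have /compact_bounded := continuous_compact (cc F) (@segment_compact _ 0 1).
  move=> [y [yr h]]; exists y; split => // z yz t ct /=; exact: h.
Qed.

Let equilibrium_payoff F H : symmetric_equilibrium payoff C F ->
  \int[law H]_(x in I01) interim_payoff payoff F x - C H <=
  \int[law F]_(x in I01) interim_payoff payoff F x - C F.
Proof.
case: gp => pm pb _ _ _ _.
move=> /(_ H); rewrite /net_payoff eqxx.
rewrite (expected_payoff n M _ (pm ord0) (pb ord0)).
have := expected_payoff n M payoff (pm ord0) (pb ord0) F F.
(* Taking H = F in the deviation formula yields the equilibrium payoff itself. *)
have -> : (fun j : 'I_n.+1 =>
    law (if j == ord0 then F else F) : probability R R) = (fun=> law F).
  by apply/funext => j; rewrite if_same.
by move=> ->.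
Qed.

(** The gross payoff is affine along [mix e F G], so its increment is exactly e times the left-hand
    side. Equilibrium bounds this by the cost increment; after division by e the bound survives the
    limit, which (C2) identifies. *)
Lemma equilibrium_derivative_le F G : symmetric_equilibrium payoff C F ->
  \int[law G]_(x in I01) interim_payoff payoff F x -
  \int[law F]_(x in I01) interim_payoff payoff F x <=
  \int[law G]_(x in I01) c F x - \int[law F]_(x in I01) c F x.
Proof.
move=> eqF; case: (cf) => _ _ _ /(_ F G) cd _.
apply: (cvgr_to_ge cd); near=> e.
have e0 : 0 < e by near: e; exact: nbhs_right_gt.
have e1 : e <= 1 by near: e; exact: nbhs_right_le.
have e01 : 0 <= e <= 1 by rewrite e1 ltW.
have := equilibrium_payoff F (mix e F G) eqF.
(* Nonnegativity of the integrand comes from (P1). *)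
rewrite Rintegral_law_mix//; last by move=> x /(a01 F)/andP[].
set aF := \int[law F]_(x in I01) _; set aG := \int[law G]_(x in I01) _.
rewrite ler_pdivlMl// => h; lra.
Unshelve. all: by end_near. Qed.

(** The dF-mean of Phi(F, .), kept as a difference of integrals to match the derivative
    inequality. *)
Let lambda F := \int[law F]_(x in I01) interim_payoff payoff F x -
  \int[law F]_(x in I01) c F x.

Lemma Phi_le_mean F x : symmetric_equilibrium payoff C F -> 0 <= x <= 1 ->
  Phi payoff c F x <= lambda F.
Proof.
move=> eqF x01.
have I01x : I01 x by rewrite /I01 /= in_itv.
have := equilibrium_derivative_le F (dirac_cdf01 x x01) eqF.
rewrite (Rintegral_law_dirac _ _ _ _ mI01 (ma F) I01x).
rewrite (Rintegral_law_dirac _ _ _ _ mI01 (mc F) I01x).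
rewrite /Phi /lambda.
by set aF := Rintegral _ _ _; set cF := Rintegral _ _ _ => ?; lra.
Qed.

(** The gap [lambda F - Phi payoff c F x] is nonnegative on [0, 1] and integrates to 0, since dF has
    mass 1 there and [lambda F] is the mean; hence it vanishes almost everywhere. *)
Lemma Phi_ae F : symmetric_equilibrium payoff C F ->
  {ae law F, forall x, I01 x -> Phi payoff c F x = lambda F}.
Proof.
move=> eqF.
have law01 : law F I01 = 1%E.
  transitivity (F 1)%:E; first exact: law_itv.
  by rewrite cdf01_ge1.
pose f x := (lambda F - Phi payoff c F x)%:E.
have iPhi : (law F).-integrable I01 (EFin \o Phi payoff c F).
  exact: (integrableB mI01 (integrable_a (law F) F) (integrable_c (law F) F)).
have ilambda : (law F).-integrable I01 (EFin \o cst (lambda F)).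
  exact: finite_measure_integrable_cst.
have if_ : (law F).-integrable I01 f by exact: (integrableB mI01 ilambda iPhi).
have f0 : (\int[law F]_(x in I01) `|f x| = 0)%E.
  transitivity (\int[law F]_(x in I01) f x)%E.
    apply: eq_integral => x; rewrite inE /I01 /= in_itv/= => x01.
    by rewrite ger0_norm// subr_ge0 Phi_le_mean.
  rewrite -[LHS]fineK; last exact: integrable_fin_num.
  congr EFin.
  transitivity (\int[law F]_(x in I01) (lambda F - Phi payoff c F x)) => //.
  rewrite RintegralB// [X in _ - X]RintegralB//; last 2 first.
  - exact: integrable_a.
  - exact: integrable_c.
  rewrite Rintegral_cst//; transitivity (lambda F * 1 - lambda F).
    by congr (_ * _ - _); rewrite [X in fine X]law01.
  by rewrite mulr1 subrr.
have mf : measurable_fun I01 f by case/integrableP: if_.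
have /(ae_eq_integral_abs (law F) mI01 mf) := f0.
apply: filterS => x h /h [] /eqP.
by rewrite subr_eq0 => /eqP.
Qed.

Lemma Phi_support F x : symmetric_equilibrium payoff C F ->
  measure_support (law F) x -> Phi payoff c F x = lambda F.
Proof.
move=> eqF sx; have x01 := support_law_itv _ _ _ sx.
have I01x : I01 x by rewrite /I01 /= in_itv.
have aePhi := Phi_ae F eqF.
(* An atom of F is charged by the a.e. equality; elsewhere a_F is continuous. *)
have [Fx0|Fx0] := eqVneq (law F [set x]) 0%E; last first.
  (* If equality failed at x, then x would lie in the exceptional null set, contradicting the
     positive mass of the atom. *)
  apply: contrapT => Phix; case: aePhi => N [mN N0 PN].
  move/negP: Fx0; apply; rewrite -measure_le0 -N0.
  apply: le_measure; rewrite ?inE// => _ ->.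
  by apply: PN => /= /(_ I01x).
have [y yP yx] := support_approx _ _ _ _ sx aePhi.
have ay : interim_payoff payoff F (y k) @[k --> \oo] -->
    interim_payoff payoff F x.
  apply: (interim_payoff_cvg _ _ M) => // k; by have [] := yP k.
have cy : c F (y k) @[k --> \oo] --> c F x.
  case: (cf) => _ _ /(_ F)/subspace_continuousP/(_ x I01x) cx _ _.
  apply: (cvg_comp y (c F) _ cx) => A /= h.
  have yA : \forall k \near \oo, I01 (y k) -> A (y k) := yx _ h.
  apply: filterS yA => k; apply; have [+ _] := yP k.
  by rewrite /I01 /= in_itv.
(* Along y the values of Phi(F, .) tend to its value at x and are constantly [lambda F]; limits are
   unique. *)
have Phiy : Phi payoff c F (y k) @[k --> \oo] --> Phi payoff c F x.
  exact: cvgB ay cy.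
have Phiyl : Phi payoff c F (y k) @[k --> \oo] --> lambda F.
  apply: cvg_near_cst; apply: nearW => k; by have [] := yP k.
exact: (cvg_unique (@norm_hausdorff _ R) Phiy Phiyl).
Qed.

End equilibrium.

Theorem proposition3p7 (R : realType) (n : nat) (pibar : R)
    (payoff : 'I_n.+2 -> n.+2.-tuple R -> R)
    (C : cdf01 R -> R) (c : cdf01 R -> R -> R) (F : cdf01 R) :
  gross_payoffs pibar payoff ->
  cost_functional pibar C c ->
  symmetric_equilibrium payoff C F ->
  exists lambda_g : R,
    (forall x : R, 0 <= x <= 1 -> Phi payoff c F x <= lambda_g) /\
    (forall x : R, measure_support (law F) x -> Phi payoff c F x = lambda_g).
Proof.
(* The witness, fixed by unification, is the dF-mean of Phi(F, .). *)
move=> gp cf eqF; eexists; split => [x x01|x sx].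
  exact: (Phi_le_mean _ _ _ _ _ gp cf).
exact: (Phi_support _ _ _ _ _ gp cf).
Qed.
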